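(* Let $p>2$ be a prime number and let $x,y,z$ be positive integers such that $$(4x-p)yz=x(y+z).$$ If $p\equiv 1\pmod 4$, then $\left(\frac{yz}{p}\right)=\left(\frac{y+z}{p}\right)=-1$, and if $p\equiv 3\pmod 4$, then $\left(\frac{yz}{p}\right)=\left(\frac{y+z}{p}\right)=1$.
   Context: For an odd prime $p$ and an integer $m$, $\left(\frac{m}{p}\right)$ denotes the Legendre symbol: it is $1$ if $p\nmid m$ and $m$ is a quadratic residue modulo $p$, $-1$ if $p\nmid m$ and $m$ is a quadratic nonresidue modulo $p$, and $0$ if $p\mid m$. *)

(* Defs.v *)
From mathcomp Require Import all_boot all_order all_algebra.

Set Implicit Arguments.
Unset Strict Implicit.
Unset Printing Implicit Defensive.

Import Order.TTheory GRing.Theory Num.Theory.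
Local Open Scope ring_scope.

(* The witness ranges over the representatives 0, ..., p - 1 so that the
   predicate is boolean; see quadratic_residueP for arbitrary integers. *)
Definition quadratic_residue (p : nat) (m : int) : bool :=
  [exists a : 'I_p, (a%:Z ^+ 2 == m %[mod p%:Z])%Z].

Lemma quadratic_residueP (p : nat) (m : int) (p_gt0 : (0 < p)%N) :
  reflect (exists a : int, (a ^+ 2 = m %[mod p%:Z])%Z) (quadratic_residue p m).
Proof.
apply: (iffP existsP) => [[a /eqP ha]|[a ha]]; first by exists a%:Z.
have p_neq0 : p%:Z != 0 by rewrite eqz_nat -lt0n.
have r_ge0 : 0 <= (a %% p%:Z)%Z by rewrite modz_ge0.
have r_lt : (`|(a %% p%:Z)%Z| < p)%N by rewrite -ltz_nat gez0_abs // ltz_pmod.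
by exists (Ordinal r_lt); rewrite /= gez0_abs // modzXm; apply/eqP.
Qed.

(* Legendre symbol (m / p); meaningful for p an odd prime. *)
Definition legendre (m : int) (p : nat) : int :=
  if (p%:Z %| m)%Z then 0 else if quadratic_residue p m then 1 else -1.

(* Main.v *)
(** Writing y = g a, z = g b with a, b coprime, the equation forces x = a b t
   and g = t s with p + m = 4 a b t and m s = a + b, so that yz = g^2 (ab) and
   (yz/p) = (ab/p). Gauss's lemma expresses this symbol as a sign count E(ab, p).
   By exchanging the order of counting of lattice points, E(D, n) depends only
   on n up to sign modulo 4D, hence E(ab, p) = E(ab, m). The sign count is
   multiplicative in D for every odd n, prime or not, and ab = -a^2 modulo m,
   so E(ab, m) = E(-1, m), the parity of (m - 1) / 2. No reciprocity law is
   needed. Finally y + z = 4yz modulo p gives the second symbol. *)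
Require Import Defs.
From mathcomp Require Import all_boot all_order all_algebra.
From mathcomp Require Import finfield zify ring.

Set Implicit Arguments.
Unset Strict Implicit.
Unset Printing Implicit Defensive.

Import Order.TTheory GRing.Theory Num.Theory.
Local Open Scope ring_scope.

(** * Least absolute residues and the sign count for an odd modulus *)

Section SignCount.
Local Open Scope nat_scope.

(* The residue of least absolute value of [r] modulo [n] is [absres n r] up to
   sign, and [negres n r] tells whether that sign is negative. *)
Definition negres (n r : nat) : bool := n < 2 * (r %% n).
Definition absres (n r : nat) : nat :=
  if negres n r then n - r %% n else r %% n.

(** E(d, n) of the overview, with the modulus as first argument. It is defined for every modulus
    because it is also taken at [m], which may be composite. *)
Definition sign_count (n d : nat) : bool :=
  \big[addb/false]_(1 <= k < n./2.+1) negres n (d * k).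

Lemma coprime_modn_gt0 (n d k : nat) : coprime d n -> 0 < k < n -> 0 < (d * k) %% n.
Proof.
move=> cdn /andP[k0 kn]; rewrite lt0n; apply/negP => nk.
have: n %| d * k by [].
rewrite Gauss_dvdr 1?coprime_sym // => /(dvdn_leq k0); lia.
Qed.

Lemma absres_cong (n r : nat) : odd n ->
  exists q, if negres n r then r + absres n r = q * n
            else r = q * n + absres n r.
Proof.
move=> on; have n0 := odd_gt0 on.
rewrite /absres; have E := divn_eq r n; have L := ltn_pmod r n0.
case: ifP => h; last by exists (r %/ n); rewrite {1}E.
by exists (r %/ n).+1; rewrite {1}E mulSn -addnA subnKC ?(ltnW L) // addnC.
Qed.

Lemma absres_bounds (n r : nat) : odd n -> 0 < r %% n -> 0 < absres n r < n./2.+1.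
Proof.
move=> on r0; have n0 := odd_gt0 on.
have L := ltn_pmod r n0.
have E := odd_double_half n; rewrite on in E.
by rewrite /absres /negres; case: ifP => h; lia.
Qed.

Lemma dvdn_lt_eq0 (n k : nat) : n %| k -> k < n -> k = 0.
Proof. by case: k => // k /dvdn_leq - /(_ isT); lia. Qed.

(** Equal values make [d * k] and [d * l] agree up to sign modulo [n]. Cancelling [d], [n] divides
    [k - l] or [k + l]; the latter lies strictly between 0 and [n]. *)
Lemma absres_inj (n d k l : nat) : odd n -> coprime d n ->
  0 < k < n./2.+1 -> 0 < l < n./2.+1 ->
  absres n (d * k) = absres n (d * l) -> k = l.
Proof.
move=> on cdn hk hl.
have E := odd_double_half n; rewrite on in E.
have [q Hq] := absres_cong (d * k) on; have [r Hr] := absres_cong (d * l) on.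
move=> eqf; rewrite eqf in Hq.
have sub u v w e : d * u + w = e * n + (d * v + w) -> v <= u < v + n -> u = v.
  move=> H /andP[vu uv]; have : n %| d * (u - v).
    by apply/dvdnP; exists e; rewrite mulnBr; lia.
  rewrite Gauss_dvdr 1?coprime_sym // => /dvdn_lt_eq0; lia.
have add : n %| d * (k + l) -> k = l.
  rewrite Gauss_dvdr 1?coprime_sym // => /dvdn_lt_eq0; lia.
(* Subtraction truncates, so both orders are used: each of [k - l] and [l - k] is a multiple of [n]
   below [n], hence 0. *)
have diff : n %| d * k - d * l -> n %| d * l - d * k -> k = l.
  rewrite -!mulnBr !Gauss_dvdr 1?coprime_sym // => /dvdn_lt_eq0 A /dvdn_lt_eq0; lia.
move: Hq Hr; case: ifP => _; case: ifP => _ Hq Hr.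
- apply: diff; apply/dvdnP; [exists (q - r)|exists (r - q)]; rewrite mulnBl; lia.
- apply: add; apply/dvdnP; exists (q + r); rewrite mulnDl mulnDr; lia.
- apply: add; apply/dvdnP; exists (q + r); rewrite mulnDl mulnDr; lia.
- apply: diff; apply/dvdnP; [exists (q - r)|exists (r - q)]; rewrite mulnBl; lia.
Qed.

Lemma absres_perm (n d : nat) : odd n -> coprime d n ->
  perm_eq [seq absres n (d * k) | k <- index_iota 1 n./2.+1] (index_iota 1 n./2.+1).
Proof.
move=> on cdn.
have E := odd_double_half n; rewrite on in E.
have Huniq : uniq [seq absres n (d * k) | k <- index_iota 1 n./2.+1].
  rewrite map_inj_in_uniq ?iota_uniq // => k l; rewrite !mem_index_iota.
  exact: absres_inj.
apply: uniq_perm => //; first exact: iota_uniq.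
suff H : {subset [seq absres n (d * k) | k <- index_iota 1 n./2.+1] <= index_iota 1 n./2.+1}.
  by have [] := uniq_min_size Huniq H _; rewrite ?size_map.
move=> _ /mapP[k + ->]; rewrite !mem_index_iota => hk.
by apply: absres_bounds => //; apply: coprime_modn_gt0 => //; lia.
Qed.

Lemma big_absres (R : Type) (idx : R) (op : Monoid.com_law idx) (F : nat -> R)
    (n d : nat) : odd n -> coprime d n ->
  \big[op/idx]_(1 <= k < n./2.+1) F (absres n (d * k))
    = \big[op/idx]_(1 <= k < n./2.+1) F k.
Proof.
by move=> on cdn; rewrite -[RHS](perm_big _ (absres_perm on cdn)) big_map.
Qed.

Lemma eq_mod_negres (n r s : nat) : r = s %[mod n] -> negres n r = negres n s.
Proof. by rewrite /negres => ->. Qed.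

(** The two remainders add up to [n], which is odd, so exactly one of them exceeds half of [n]. *)
Lemma negres_opp (n r s : nat) : odd n -> 0 < r %% n -> n %| r + s ->
  negres n s = ~~ negres n r.
Proof.
move=> on r0 nrs; have n0 := odd_gt0 on.
have Lr := ltn_pmod r n0; have Ls := ltn_pmod s n0.
have : n %| r %% n + s %% n by rewrite /dvdn modnDm.
case/dvdnP => q Hq.
have q1 : q = 1 by nia.
have E := odd_double_half n; rewrite on in E.
by rewrite /negres; apply/idP/idP; rewrite -?leqNgt; lia.
Qed.

Lemma negresM (n d e k : nat) : odd n -> coprime d n -> coprime e n ->
  0 < k < n -> negres n (d * e * k) = negres n (e * k) (+) negres n (d * absres n (e * k)).
Proof.
move=> on cd ce hk; have [q] := absres_cong (e * k) on.
case: ifP => _ Hq /=; last first.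
  apply: eq_mod_negres; rewrite -mulnA {1}Hq mulnDr mulnA modnMDl //.
rewrite (@negres_opp n (d * e * k) (d * absres n (e * k))) ?negbK //.
- apply: coprime_modn_gt0 => //; by rewrite coprimeMl cd ce.
- by apply/dvdnP; exists (d * q); rewrite -!mulnA -mulnDr Hq.
Qed.

(** The sign of [d * e * k] is that of [e * k] times that of [d * absres n (e * k)], and
    [absres n (e * k)] runs through the half range as [k] does. *)
Lemma sign_countM (n d e : nat) : odd n -> coprime d n -> coprime e n ->
  sign_count n (d * e) = sign_count n d (+) sign_count n e.
Proof.
move=> on cd ce; have E := odd_double_half n; rewrite on in E.
rewrite /sign_count -(big_absres _ (fun k => negres n (d * k)) on ce) -big_split /=.
rewrite !big_nat; apply: eq_bigr => k hk; rewrite addbC negresM //; lia.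
Qed.

Lemma eq_mod_sign_count (n d e : nat) : d = e %[mod n] ->
  sign_count n d = sign_count n e.
Proof.
move=> de; apply: eq_bigr => k _; apply: eq_mod_negres.
by rewrite -modnMml de modnMml.
Qed.

Lemma sign_count_pred (n : nat) : odd n -> sign_count n n.-1 = odd n./2.
Proof.
move=> on; have E := odd_double_half n; rewrite on in E.
transitivity (\big[addb/false]_(1 <= k < n./2.+1) true).
  rewrite /sign_count !big_nat; apply: eq_bigr => k hk.
  rewrite (@negres_opp n k) //.
  - by rewrite /negres modn_small; lia.
  - by rewrite modn_small; lia.
  - apply/dvdnP; exists k; rewrite -{1}[k]mul1n -mulnDl mulnC; congr (_ * _); lia.
by rewrite big_const_nat subn1 /=; elim: n./2 => //= h ->; rewrite addTb.
Qed.

(** * Lattice point counts and change of modulus *)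

Lemma negres_odd_divn (n r : nat) : odd n -> negres n r = odd ((2 * r) %/ n).
Proof.
move=> on; have n0 := odd_gt0 on.
have E := odd_double_half n; rewrite on in E.
(* The part [2 * (r %/ n)] is even; what remains is the quotient of [2 * (r %% n)], which is 0 or
   1. *)
rewrite /negres {2}(divn_eq r n) mulnDr mulnA divnMDl // oddD oddM /=.
have L := ltn_pmod r n0; case: ltnP => h.
  have -> : (2 * (r %% n)) = 1 * n + (2 * (r %% n) - n) by lia.
  by rewrite divnMDl // divn_small //; lia.
by rewrite divn_small //; lia.
Qed.

Lemma sum_leq_divn (N u n : nat) : 0 < n -> u < N * n ->
  u %/ n = \sum_(1 <= l < N) (l * n <= u).
Proof.
move=> n0 uN.
have qN : u %/ n < N by rewrite ltn_divLR.
rewrite (eq_bigr (fun l => nat_of_bool (l <= u %/ n))); last first.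
  by move=> l _; rewrite leq_divRL.
rewrite (@big_cat_nat _ _ _ (u %/ n).+1) //=.
rewrite (eq_big_nat _ _ (F2 := fun=> 1)); last first.
  by move=> i; rewrite ltnS => /andP[_ ->].
rewrite [X in _ = _ + X]big_nat_cond [X in _ = _ + X]big1 ?addn0; last first.
  by move=> i /andP[/andP[h _] _]; rewrite leqNgt h.
by rewrite sum_nat_const_nat muln1 subn1.
Qed.

Lemma sum_gtn_divn (h u e : nat) : 0 < e -> u < e * h.+1 ->
  h - u %/ e = \sum_(1 <= k < h.+1) (u < e * k).
Proof.
move=> e0 ueh.
have qh : u %/ e < h.+1 by rewrite ltn_divLR // mulnC.
rewrite (eq_bigr (fun k => nat_of_bool (u %/ e < k))); last first.
  by move=> k _; rewrite ltn_divLR // mulnC.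
rewrite (@big_cat_nat _ _ _ (u %/ e).+1) //=.
rewrite big_nat_cond big1 ?add0n; last first.
  by move=> i /andP[/andP[_ hi] _]; rewrite ltnNge -ltnS hi.
rewrite (eq_big_nat _ _ (F2 := fun=> 1)); last by move=> i /andP[-> _].
by rewrite sum_nat_const_nat muln1 subSS.
Qed.

(* Both sides count, modulo 2, the lattice points (k, l) with 0 < k < n/2,
   0 < l < d and l n < 2 d k. *)
Lemma sign_count_lattice (n d : nat) : odd n -> coprime d n -> 0 < d ->
  sign_count n d =
  \big[addb/false]_(1 <= l < d) odd (n./2 - (l * n) %/ (2 * d)).
Proof.
move=> on cd d0; have E := odd_double_half n; rewrite on in E.
have n0 := odd_gt0 on.
transitivity (odd (\sum_(1 <= k < n./2.+1) \sum_(1 <= l < d) (l * n <= 2 * (d * k)))).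
  rewrite (big_morph odd oddD (erefl _)) /sign_count !big_nat.
  apply: eq_bigr => k hk; rewrite negres_odd_divn // -sum_leq_divn //; nia.
rewrite exchange_big /= (big_morph odd oddD (erefl _)) !big_nat.
apply: eq_bigr => l hl; congr odd; rewrite sum_gtn_divn; [|lia|nia].
rewrite !big_nat; apply: eq_bigr => k hk; rewrite -mulnA ltn_neqAle.
(* The two counts could differ only on the line [l * n = 2 * d * k], where [d] would divide
   [l < d]. *)
case: eqP => //= H; exfalso.
have : d %| l * n by apply/dvdnP; exists (2 * k); rewrite H; lia.
by rewrite Gauss_dvdl // => /dvdn_leq; lia.
Qed.

(** The lattice sums agree term by term. As [l * n] and [l * m] add up to [2 * l * t] times [2 * d]
    and neither is a multiple of [2 * d], their quotients add up to [2 * l * t - 1]. Likewise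
    [n./2 + m./2 = 2 * d * t - 1], so the parities of the two differences coincide. *)
Lemma sign_count_opp_mod4 (n m d t : nat) : odd n -> odd m -> 0 < d ->
  coprime d n -> coprime d m -> n + m = 4 * d * t ->
  sign_count n d = sign_count m d.
Proof.
move=> on om d0 cn cm H; rewrite !sign_count_lattice // !big_nat.
have En := odd_double_half n; rewrite on in En.
have Em := odd_double_half m; rewrite om in Em.
apply: eq_bigr => l hl.
have e0 : 0 < 2 * d by lia.
have Dn := divn_eq (l * n) (2 * d); have Dm := divn_eq (l * m) (2 * d).
have Ln := ltn_pmod (l * n) e0; have Lm := ltn_pmod (l * m) e0.
have r0 : 0 < (l * n) %% (2 * d).
  rewrite lt0n; apply/negP => /(dvdn_trans (dvdn_mull 2 (dvdnn d))).
  by rewrite Gauss_dvdl // => /dvdn_leq; lia.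
have hn : (l * n) %/ (2 * d) <= n./2.
  by rewrite -ltnS ltn_divLR //; nia.
have hm : (l * m) %/ (2 * d) <= m./2.
  by rewrite -ltnS ltn_divLR //; nia.
move: ((l * n) %/ _) ((l * m) %/ _) (_ %% _) (_ %% _) Dn Dm Ln Lm r0 hn hm.
move=> q r u v Dn Dm Ln Lm r0 hn hm.
have HS : l * n + l * m = 2 * l * t * (2 * d) by rewrite -mulnDr H; lia.
have Huv : u + v = 2 * d.
  have : (2 * d) %| u + v.
    have : (2 * d) %| (q + r) * (2 * d) + (u + v).
      by apply/dvdnP; exists (2 * l * t); rewrite -HS Dn Dm; lia.
    by rewrite dvdn_addr // dvdn_mull.
  by case/dvdnP => c Hc; have -> : u + v = 1 * (2 * d); [have : c = 1 by nia|]; lia.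
have Hqr : q + r + 1 = 2 * (l * t).
  apply/eqP; rewrite -(eqn_pmul2r e0); apply/eqP; lia.
have Hh : n./2 + m./2 + 1 = 2 * (d * t) by lia.
rewrite !oddB //.
have On : odd (n./2 + m./2 + 1) = false by rewrite Hh mul2n odd_double.
have Oq : odd (q + r + 1) = false by rewrite Hqr mul2n odd_double.
move: On Oq; rewrite !oddD.
by case: (odd n./2); case: (odd m./2); case: (odd q); case: (odd r).
Qed.

Lemma sign_count_opp_square (m a b : nat) : odd m -> coprime a m ->
  m %| a + b -> sign_count m (a * b) = odd m./2.
Proof.
move=> om ca mab; have m0 := odd_gt0 om.
rewrite (@eq_mod_sign_count m _ (m.-1 * (a * a))); last first.
  apply/eqP; rewrite -(eqn_modDr (a * a)) -{3}[a * a]mul1n -mulnDl addn1 prednK //.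
  by rewrite modnMr -mulnDr addnC -/(dvdn _ _) dvdn_mull.
have cm : coprime m.-1 m by rewrite coprimePn.
by rewrite !sign_countM ?coprimeMl ?ca ?cm // addbb addbF sign_count_pred.
Qed.

End SignCount.

(** * Gauss's lemma and Euler's criterion in ['F_p] *)

Section Euler.
Variable p : nat.
Hypotheses (p_prime : prime p) (p_odd : odd p).

Let p_pchar : p \in [pchar 'F_p] := pchar_Fp p_prime.

Lemma Fp_nat_eq0 (k : nat) : ((k%:R : 'F_p) == 0) = (p %| k)%N.
Proof. by rewrite -(dvdn_pcharf p_pchar). Qed.

Lemma Fp_int_eq0 (k : int) : ((k%:~R : 'F_p) == 0) = (p%:Z %| k)%Z.
Proof.
by case: k => k; rewrite ?NegzE ?mulrNz ?oppr_eq0 ?dvdzN -pmulrn Fp_nat_eq0.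
Qed.

Lemma Fp_expf_half2 (u : 'F_p) : u != 0 -> (u ^+ 2) ^+ p./2 = 1.
Proof.
move=> u0; apply: (mulfI u0); rewrite mulr1 -exprM -exprS mul2n.
have -> : (p./2.*2.+1 = p)%N by rewrite -[RHS](odd_double_half p) p_odd.
by have := expf_card u; rewrite card_Fp.
Qed.

(** The product of all [d * k] over the half range is [d ^ p./2] times a factorial, and also the
    product of the signs times the same factorial, which is invertible modulo [p]. *)
Lemma gauss_lemma (d : nat) : coprime d p ->
  (d%:R : 'F_p) ^+ p./2 = (-1) ^+ sign_count p d.
Proof.
move=> cdp.
have E := odd_double_half p; rewrite p_odd in E.
have fact0 : \prod_(1 <= k < p./2.+1) (k%:R : 'F_p) != 0.
  rewrite big_nat; elim/big_ind: _ => [|u v u0 v0|k hk].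
  - exact: oner_neq0.
  - by rewrite mulf_neq0.
  by rewrite Fp_nat_eq0; apply/negP => /dvdn_leq; lia.
apply: (mulIf fact0).
rewrite -{2}(big_absres _ (fun k => (k%:R : 'F_p)) p_odd cdp).
have sgnM : {morph (fun b : bool => (-1 : 'F_p) ^+ b) : b c / b (+) c >-> b * c}.
  by move=> b c; rewrite signr_addb.
rewrite /sign_count (big_morph _ sgnM (erefl _)) -big_split /=.
have -> : (d%:R : 'F_p) ^+ p./2 = \prod_(1 <= k < p./2.+1) d%:R.
  by rewrite prodr_const_nat subn1.
rewrite -big_split /=; apply: eq_bigr => k _.
rewrite -natrM; have [q] := absres_cong (d * k) p_odd.
have p0 : (p%:R : 'F_p) = 0 by apply/eqP; rewrite Fp_nat_eq0.
case: ifP => _ /(congr1 (fun n => n%:R : 'F_p)); rewrite natrD (natrM _ q) p0 mulr0.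
  by move/eqP; rewrite addr_eq0 => /eqP->; rewrite expr1 mulN1r.
by rewrite add0r expr0 mul1r.
Qed.

Lemma quadratic_residue_Fp (k : int) :
  quadratic_residue p k <-> exists u : 'F_p, u ^+ 2 = k%:~R.
Proof.
have p0 := prime_gt0 p_prime.
have sq (a : int) : (a ^+ 2 = k %[mod p%:Z])%Z <-> (a%:~R : 'F_p) ^+ 2 = k%:~R.
  rewrite -rmorphXn; split => [/eqP|/eqP].
    by rewrite eqz_mod_dvd -Fp_int_eq0 rmorphB subr_eq0 => /eqP.
  by rewrite -subr_eq0 -rmorphB Fp_int_eq0 -eqz_mod_dvd => /eqP.
split=> [/(quadratic_residueP _ p0)[a /sq <-]|[u Hu]]; first by exists a%:~R.
apply/(quadratic_residueP _ p0); exists (u : nat)%:Z; apply/sq.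
by rewrite -pmulrn natr_Zp.
Qed.

(* A nonresidue [w] with [w ^+ h = 1] would be a root of ['X^h - 1] besides the
   [h] squares of [1, ..., h]. *)
Lemma expf_half_eq1_square (w : 'F_p) : w ^+ p./2 = 1 -> exists u, u ^+ 2 = w.
Proof.
move=> w1; have E := odd_double_half p; rewrite p_odd in E.
have p1 := prime_gt1 p_prime.
pose sq := [seq (k%:R : 'F_p) ^+ 2 | k <- index_iota 1 p./2.+1].
have [/mapP[k _ ->]|wsq] := boolP (w \in sq); first by exists k%:R.
have h0 : (0 < p./2)%N by lia.
have := @max_poly_roots _ ('X^(p./2) - 1 : {poly 'F_p}) (w :: sq).
rewrite -size_poly_eq0 size_XnsubC // => /(_ isT).
rewrite /= size_map size_iota subn1 ltnn wsq => absurd_roots.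
have nz k : (0 < k < p)%N -> (k%:R : 'F_p) != 0.
  by move=> hk; rewrite Fp_nat_eq0; apply/negP => /dvdn_leq; lia.
suff : false by [].
apply: absurd_roots.
  apply/andP; split; first by rewrite rootE !hornerE w1 subrr.
  apply/allP => _ /mapP[k + ->]; rewrite mem_index_iota => hk.
  by rewrite rootE !hornerE Fp_expf_half2 ?subrr // nz //; lia.
(* The squares are distinct: equal squares give [k = l] or [k = - l] in ['F_p], and [0 < k + l < p]
   rules out the second. *)
rewrite map_inj_in_uniq ?iota_uniq // => k l; rewrite !mem_index_iota => hk hl.
move/eqP; rewrite eqf_sqr => /orP[]; last first.
  by rewrite -addr_eq0 -natrD (negbTE (nz _ _)) //; lia.
wlog kl : k l hk hl / (l <= k)%N.
  move=> W e; case: (leqP l k) => [|/ltnW] kl; first exact: W.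
  by apply/esym; apply: W => //; rewrite eq_sym.
rewrite -subr_eq0 -natrB // => e; apply/eqP; rewrite eqn_leq kl andbT leqNgt.
by apply/negP => lk; move: e; rewrite (negbTE (nz _ _)) //; lia.
Qed.

(** Euler's criterion. The symbol 0 is excluded because the power is nonzero; a residue has power 1,
    which differs from -1 as [p] is odd. *)
Lemma legendre_sign (k : int) (b : bool) :
  (k%:~R : 'F_p) ^+ p./2 = (-1) ^+ b -> legendre k p = (-1) ^+ b.
Proof.
move=> kb; have E := odd_double_half p; rewrite p_odd in E.
have p1 := prime_gt1 p_prime.
have k0 : k%:~R != 0 :> 'F_p.
  apply: contra_eq_neq kb => ->; rewrite expr0n eq_sym.
  have -> : (p./2 == 0)%N = false by lia.
  by rewrite signr_eq0.
rewrite /legendre -Fp_int_eq0 (negbTE k0).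
have [/quadratic_residue_Fp[u Hu]|nqr] := boolP (quadratic_residue p k).
  have u0 : u != 0 by apply: contraNneq k0 => u0; rewrite -Hu u0 expr0n.
  case: b kb => //; rewrite -Hu Fp_expf_half2 // expr1 => /eqP.
  rewrite -addr_eq0 -(natrD _ 1 1) Fp_nat_eq0 => /dvdn_leq; lia.
case: b kb => //; rewrite expr0 => /expf_half_eq1_square[u Hu].
by case/negP: nqr; apply/quadratic_residue_Fp; exists u.
Qed.

End Euler.

(** * Parametrization of the solutions *)

Section Parametrization.
Local Open Scope nat_scope.

(** If [x = c * p], division by [p] gives [4 * c * (y * z) = c * (y + z) + y * z], whose right side
    is at most [3 * c * (y * z)]. *)
Lemma solution_coprime (p x y z : nat) : prime p -> 0 < x -> 0 < y -> 0 < z ->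
  4 * x * (y * z) = x * (y + z) + p * (y * z) -> coprime x p.
Proof.
move=> pp x0 y0 z0 H; have p0 := prime_gt0 pp.
rewrite coprime_sym prime_coprime //; apply/negP => /dvdnP[c Hc].
have yz : y + z <= 2 * (y * z) by nia.
have c0 : 0 < c by nia.
have K : 4 * c * (y * z) = c * (y + z) + y * z.
  by apply/eqP; rewrite -(eqn_pmul2r p0); apply/eqP; move: H; rewrite Hc; lia.
have : c * (y + z) <= c * (2 * (y * z)) by rewrite leq_mul2l yz orbT.
have : 0 < y * z by rewrite muln_gt0 y0.
by move: (y * z) K; nia.
Qed.

(** Successive cancellation: [a * b] is coprime to [a + b], hence divides [x]; the quotient [t] is
    coprime to [p], hence divides [g]; the quotient [s] then divides [a + b], with quotient [m]. *)
Lemma solution_parametrization (p x y z : nat) : prime p ->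
  0 < x -> 0 < y -> 0 < z -> 4 * x * (y * z) = x * (y + z) + p * (y * z) ->
  exists a b g t m,
    [/\ y = g * a, z = g * b, coprime a b & p + m = 4 * (a * b) * t] /\
    [/\ 0 < a * b, m %| a + b, coprime (a * b) p & coprime g p].
Proof.
move=> pp x0 y0 z0 H; have p0 := prime_gt0 pp.
have pNx := solution_coprime pp x0 y0 z0 H.
have [y' [z' [cab Ey Ez]]] :
    exists y' z', [/\ coprime y' z', y = gcdn y z * y' & z = gcdn y z * z'].
  have g0 : 0 < gcdn y z by rewrite gcdn_gt0 y0.
  have /dvdnP[a Ha] := dvdn_gcdl y z; have /dvdnP[b Hb] := dvdn_gcdr y z.
  exists a, b; split; [|by rewrite mulnC|by rewrite mulnC].
  by rewrite /coprime -(eqn_pmul2r g0) mul1n muln_gcdl -Ha -Hb.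
move: (gcdn y z) y' z' cab Ey Ez => g a b cab Ey Ez.
have [g0 a0] : 0 < g /\ 0 < a by apply/andP; rewrite -muln_gt0 -Ey.
have b0 : 0 < b by move: z0; rewrite Ez muln_gt0 => /andP[].
have ab0 : 0 < a * b by rewrite muln_gt0 a0.
have H1 : 4 * x * g * (a * b) = x * (a + b) + p * g * (a * b).
  by apply/eqP; rewrite -(eqn_pmul2l g0); apply/eqP; move: H; rewrite Ey Ez; lia.
have cabs : coprime (a * b) (a + b).
  by rewrite coprimeMl /coprime gcdnDl gcdnDr (gcdnC b) -/(coprime a b) cab.
have /dvdnP[t Ht] : a * b %| x.
  rewrite -(Gauss_dvdl x cabs) -(dvdn_addl _ (dvdn_mull (p * g) (dvdnn _))) -H1.
  exact: dvdn_mull.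
have t0 : 0 < t by move: x0; rewrite Ht muln_gt0 => /andP[].
have ct : coprime t p by move: pNx; rewrite Ht coprimeMl => /andP[].
have H2 : 4 * (a * b) * t * g = t * (a + b) + p * g.
  by apply/eqP; rewrite -(eqn_pmul2r ab0); apply/eqP; move: H1; rewrite Ht; lia.
have /dvdnP[s Hs] : t %| g.
  rewrite -(Gauss_dvdr g ct) -(dvdn_addr _ (dvdn_mulr (a + b) (dvdnn t))) -H2.
  by rewrite -mulnA dvdn_mull // dvdn_mulr.
have s0 : 0 < s by move: g0; rewrite Hs muln_gt0 => /andP[].
have H3 : 4 * (a * b) * t * s = a + b + p * s.
  by apply/eqP; rewrite -(eqn_pmul2r t0); apply/eqP; move: H2; rewrite Hs; lia.
have /dvdnP[m Hm] : s %| a + b.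
  by rewrite -(dvdn_addl _ (dvdn_mull p (dvdnn s))) -H3 dvdn_mull.
have H4 : p + m = 4 * (a * b) * t.
  by apply/eqP; rewrite -(eqn_pmul2r s0); apply/eqP; move: H3; rewrite Hm; lia.
(* If [p] divided [a * b], it would divide [m] and so [a + b], which is coprime to [a * b]. *)
have cabp : coprime (a * b) p.
  rewrite coprime_sym prime_coprime //; apply/negP => pab.
  have : p %| a + b.
    rewrite Hm dvdn_mulr // -(dvdn_addr _ (dvdnn p)) H4 mulnAC.
    exact: dvdn_mull.
  move=> pab'; have : p %| gcdn (a * b) (a + b) by rewrite dvdn_gcd pab.
  by rewrite (eqP cabs) dvdn1 => /eqP p1; rewrite p1 in pp.
exists a, b, g, t, m; split; split => //.
  by apply/dvdnP; exists s; rewrite Hm mulnC.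
rewrite Hs coprimeMl ct andbT coprime_sym prime_coprime //.
(* From [p <= s] follows [p + m <= m * s + 1 = a + b + 1 <= a * b + 2], which is less than
   [4 * (a * b) * t]. *)
apply/negP => /(dvdn_leq s0) ps.
have m0 : 0 < m by case: m Hm {H4} => [|//]; rewrite mul0n; lia.
have ms : m + s <= m * s + 1 by move: m0 s0; clear; nia.
have ab : a + b <= a * b + 1 by move: a0 b0; clear; nia.
have := leq_pmulr (4 * (a * b)) t0; lia.
Qed.

End Parametrization.

Theorem theorem1p8 (p : nat) (x y z : int)
    (p_prime : prime p) (p_gt2 : (2 < p)%N)
    (x_gt0 : 0 < x) (y_gt0 : 0 < y) (z_gt0 : 0 < z)
    (hxyz : (4 * x - p%:Z) * (y * z) = x * (y + z)) :
  ((p = 1 %[mod 4])%N ->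
     legendre (y * z) p = -1 /\ legendre (y + z) p = -1) /\
  ((p = 3 %[mod 4])%N ->
     legendre (y * z) p = 1 /\ legendre (y + z) p = 1).
Proof.
have p_odd : odd p by case: (even_prime p_prime) p_gt2 => [->|].
case: x y z x_gt0 y_gt0 z_gt0 hxyz => // x [] // y [] // z x0 y0 z0 hxyz.
have H : (4 * x * (y * z) = x * (y + z) + p * (y * z))%N by lia.
have [a [b [g [t [m [[Ey Ez cab Hpm] [ab0 mab cabp cgp]]]]]]] :=
  solution_parametrization p_prime x0 y0 z0 H.
have om : odd m.
  by have : odd (p + m) = false; [rewrite Hpm -!mulnA oddM | rewrite oddD p_odd; case: odd].
have cam : coprime a m by apply: coprime_dvdr mab _; rewrite /coprime gcdnDl.
have cbm : coprime b m.
  by apply: coprime_dvdr mab _; rewrite /coprime gcdnDr gcdnC.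
have sgn : sign_count p (a * b) = odd m./2.
  rewrite (sign_count_opp_mod4 p_odd om ab0 cabp _ Hpm) ?coprimeMl ?cam //.
  exact: sign_count_opp_square.
have Epow : ((y * z)%N%:R : 'F_p) ^+ p./2 = (-1) ^+ odd m./2.
  rewrite -sgn -(gauss_lemma p_prime p_odd cabp).
  have -> : (y * z = g ^ 2 * (a * b))%N by rewrite Ey Ez; ring.
  rewrite natrM exprMn natrX Fp_expf_half2 ?mul1r //.
  by rewrite Fp_nat_eq0 // -prime_coprime // coprime_sym.
(* The equation modulo [p], with the invertible [x] cancelled; 4 is written as a square so that its
   power [p./2] is 1. *)
have sum4 : ((y + z)%N%:R : 'F_p) = 2 ^+ 2 * (y * z)%N%:R.
  have x0' : (x%:R : 'F_p) != 0.
    rewrite Fp_nat_eq0 // -prime_coprime // coprime_sym.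
    exact: solution_coprime H.
  apply/esym/(mulfI x0').
  move/(congr1 (fun k => k%:R : 'F_p)): H.
  rewrite natrD (natrM _ p) [p%:R](_ : _ = 0); last first.
    by apply/eqP; rewrite Fp_nat_eq0.
  by rewrite mul0r addr0 !(natrM _ x) => <-; rewrite !natrM; ring.
have leg_mul : legendre (y%:Z * z%:Z) p = (-1) ^+ odd m./2.
  by apply: legendre_sign => //; rewrite -PoszM -pmulrn.
have leg_add : legendre (y%:Z + z%:Z) p = (-1) ^+ odd m./2.
  apply: legendre_sign => //; rewrite -PoszD -pmulrn sum4 exprMn Epow.
  rewrite Fp_expf_half2 ?mul1r // Fp_nat_eq0 //.
  by apply/negP => /dvdn_leq; lia.
have Em := odd_double_half m; rewrite om in Em.
(* Since 4 divides [p + m], [m] is 3 modulo 4 when [p] is 1, and 1 when [p] is 3; this decides the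
   parity of [m./2]. *)
have hm : (p + m = 4 * (a * b * t))%N by rewrite Hpm; lia.
rewrite leg_mul leg_add; split => hp.
  by have -> : odd m./2 by lia.
by have -> : odd m./2 = false by lia.
Qed.
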